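(* Let $\alpha,\beta\in(-\infty,1)$, let $T:\mathcal H\to\mathcal H$ be an $\alpha$-demicontraction and $U:\mathcal H\to\mathcal H$ be a $\beta$-demicontraction with $\operatorname{Fix}T\cap\operatorname{Fix}U\neq\emptyset$. Suppose that $T$ and $U$ satisfy the demi closedness principle and that $\alpha+\beta<\alpha\beta$. Let $\tau:\mathcal H\to(0,+\infty)$ be a function such that, for all $x\in\mathcal H\setminus\operatorname{Fix}(UT)$, $$\frac{2\|a_1+b_1\|^2}{(1-\alpha)\|a_1\|^2+(1-\beta)\|b_1\|^2+2\langle a_1,b_1\rangle}\le\tau(x)\le\frac{2(\alpha+\beta)}{\alpha+\beta-\alpha\beta},$$ where $a_1:=T(x)-x$ and $b_1:=UT(x)-T(x)$. Let $x^0\in\mathcal H$ be arbitrary, let $\lambda_k\in[\varepsilon,2-\varepsilon]$, $k\ge0$, for some $\varepsilon\in(0,1)$, and let $$x^{k+1}=x^k+\frac{\lambda_k}{\tau(x^k)}\big(UT(x^k)-x^k\big),\qquad k\ge0.$$ Then $\{x^k\}_{k=0}^\infty$ converges weakly to an element of $\operatorname{Fix}T\cap\operatorname{Fix}U$.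
   Context: $\mathcal H$ is a real Hilbert space with $\mathcal H\neq\{0\}$; $UT$ denotes the composition $U\circ T$; $\operatorname{Fix}S:=\{z\in\mathcal H:S(z)=z\}$. For $\alpha\in(-\infty,1)$, $T:\mathcal H\to\mathcal H$ with $\operatorname{Fix}T\neq\emptyset$ is an $\alpha$-demicontraction if $\|T(x)-z\|^2\le\|x-z\|^2+\alpha\|T(x)-x\|^2$ for all $x\in\mathcal H$, $z\in\operatorname{Fix}T$. An operator $T$ satisfies the demi closedness principle if for any bounded sequence $\{x^k\}$ with $\|T(x^k)-x^k\|\to0$, every weak cluster point of $\{x^k\}$ belongs to $\operatorname{Fix}T$. *)

(* Defs.v *)
From HB Require Import structures.
From mathcomp Require Import all_boot all_order all_algebra.
From mathcomp Require Import all_classical all_reals all_analysis.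
Import Order.TTheory GRing.Theory Num.Theory.
Import numFieldNormedType.Exports.

Set Implicit Arguments.
Unset Strict Implicit.
Unset Printing Implicit Defensive.

Local Open Scope classical_set_scope.
Local Open Scope ring_scope.

(* A real Hilbert space is a complete normed module [H] whose norm is the one
   induced by an inner product [ip : {dot H for idfun}]. *)
Definition norm_induced_by (R : realType) (H : completeNormedModType R)
    (ip : {dot H for idfun}) : Prop :=
  forall x : H, `|x| = Num.sqrt (ip x x).

Definition Fixpts (H : Type) (S : H -> H) : set H := [set z | S z = z].

Definition demicontraction (R : realType) (H : completeNormedModType R)
    (alpha : R) (T : H -> H) : Prop :=
  [/\ alpha < 1, Fixpts T !=set0 &
      forall x z : H, Fixpts T z ->
        `|T x - z| ^+ 2 <= `|x - z| ^+ 2 + alpha * `|T x - x| ^+ 2].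

(* By the Riesz representation theorem the functionals [ip^~ y] are all the
   continuous linear functionals on [H]. *)
Definition weakly_converges (R : realType) (H : completeNormedModType R)
    (ip : {dot H for idfun}) (u : nat -> H) (z : H) : Prop :=
  forall y : H, ip (u k) y @[k --> \oo] --> ip z y.

(* Weak cluster points are limits of weakly convergent subsequences; for bounded
   sequences these are exactly the cluster points in the weak topology. *)
Definition weak_cluster_point (R : realType) (H : completeNormedModType R)
    (ip : {dot H for idfun}) (u : nat -> H) (z : H) : Prop :=
  exists2 s : nat -> nat, increasing_seq s & weakly_converges ip (u \o s) z.

Definition demiclosed (R : realType) (H : completeNormedModType R)
    (ip : {dot H for idfun}) (T : H -> H) : Prop :=
  forall u : nat -> H, bounded_set (range u) ->
    `|T (u k) - u k| @[k --> \oo] --> (0 : R) ->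
    forall z : H, weak_cluster_point ip u z -> Fixpts T z.

(* Main.v *)
Require Import Defs.
From HB Require Import structures.
From mathcomp Require Import all_boot all_order all_algebra.
From mathcomp Require Import all_classical all_reals all_analysis.
From mathcomp Require Import ring lra.
Import Order.TTheory GRing.Theory Num.Theory.
Import numFieldNormedType.Exports.

Local Open Scope classical_set_scope.
Local Open Scope ring_scope.

(** Write [a = T x - x] and [b = U (T x) - T x], so that the step from [x] goes
    along [a + b = U (T x) - x].  For a common fixed point [z], expanding the two
    demicontraction inequalities turns them into lower bounds for [ip a (z - x)]
    and [ip b (z - T x)]; adding these gives
      [D <= 2 * ip (a + b) (z - x)], where
      [D = (1 - alpha) * `|a| ^+ 2 + (1 - beta) * `|b| ^+ 2 + 2 * ip a b]
    ([composition_ip]).  The hypothesis [alpha + beta < alpha * beta] says exactly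
    that [(1 - alpha) * (1 - beta) > 1], i.e. that the quadratic form [D] is
    positive definite, so [D] dominates a positive multiple of the residual
    [`|a| ^+ 2 + `|b| ^+ 2] ([coercive_form]).

    The lower bound on [tau x] reads [2 * `|a + b| ^+ 2 <= tau x * D], which makes
    a step of length [lambda / tau x] with [0 < lambda < 2] bring the point closer
    to every common fixed point: the squared distance drops by at least
    [lambda * (2 - lambda) * D / (2 * tau x)].  The upper bound on [tau x] keeps
    this drop above a fixed multiple of the residual ([relaxed_step_decrease]).
    Hence the sequence is Fejer monotone with respect to the common fixed points,
    and telescoping sends [a] and [b] to [0] along it.  Since [x k] and [T (x k)]
    then have the same weak cluster points, demiclosedness of [T] and of [U] puts
    all of them in the set of common fixed points, and a Fejer monotone sequence
    with this property converges weakly ([fejer_weak_cvg]).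

    That last step needs weak sequential compactness of bounded sets
    ([bounded_weak_subsequence]).  A subsequence is chosen along which the
    inner products with each term of the sequence converge; the vectors [y]
    whose inner products with the subsequence converge then form a closed
    subspace containing the sequence.  The limit functional on that subspace is
    represented by a vector of it, and an orthogonal projection reduces
    arbitrary [y] to the subspace.  Both are instances of one Riesz
    representation theorem, [riesz_closed_subspace]. *)

(** * Real sequences and subsequences *)

Lemma cauchy_seq_cvgn (R : realType) (V : completeNormedModType R)
    (u : nat -> V) :
  (forall e : R, 0 < e ->
     exists N, forall k, (N <= k)%N -> `|u N - u k| < e) ->
  cvgn u.
Proof.
move=> uC; apply/cauchy_cvgP/cauchy_exP => e e0 /=.
have [N uN] := uC _ e0.
by exists (u N); exists N => // k /= Nk; rewrite -ball_normE /=; exact: uN.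
Qed.

Lemma increasing_seq_cvgn (s : nat -> nat) :
  increasing_seq s -> s k @[k --> \oo] --> \oo.
Proof.
move=> /increasing_seqP sS A [N _ NA]; exists N => // k /= Nk; apply: NA => /=.
apply: (leq_trans Nk); elim: k {Nk} => // k /leq_ltn_trans; apply; exact: sS.
Qed.

Lemma increasing_selection (B : nat -> set nat) :
  (forall n N, exists2 k, (N < k)%N & B n k) ->
  exists2 s : nat -> nat, increasing_seq s & forall n, B n (s n).
Proof.
move=> Bunb; have /choice[g gP] : forall p : nat * nat, exists k,
    (p.2 < k)%N /\ B p.1 k.
  by move=> [n N]; have [k] := Bunb n N; exists k.
pose s := fix s n := if n is m.+1 then g (n, s m) else g (0, 0)%N.
exists s.
  by apply/increasing_seqP => n; rewrite ltEnat; case: (gP (n.+1, s n)).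
by case=> [|n] /=; [case: (gP (0, 0)%N) | case: (gP (n.+1, s n))].
Qed.

(** Bounded real sequences converge along any ultrafilter, whatever the sequence:
    this provides the limits of infinitely many sequences simultaneously. *)
Lemma ultrafilter_real_limit (R : realType) (F : set_system nat)
    (u : nat -> R) (M : R) :
  UltraFilter F -> (forall k, `|u k| <= M) ->
  exists l, forall e : R, 0 < e -> F [set k | `|u k - l| < e].
Proof.
move=> FU uM.
have [|l [_ lu]] := @segment_compact R (- M) M (u @ F).
  apply: (@filterS _ F _ setT); last exact: filterT.
  by move=> k _ /=; rewrite in_itv /= -ler_norml; exact: uM.
exists l => e e0; set B := [set k | _].
have [//|FC] := in_ultra_setVsetC B FU.
have [||y [[k Bk <-]]] := lu (u @` ~` B) (ball (l : R) e).
- by apply: (@filterS _ F _ (~` B)) => // k Bk; exists k.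
- exact: nbhsx_ballx.
- by rewrite -ball_normE /= distrC => /Bk.
Qed.

(** In place of nested subsequences, take the limits [c j] along one ultrafilter
    finer than [\oo].  Then the conditions on the first [n + 1] sequences, being
    finitely many, hold together on a member of the ultrafilter, hence at
    arbitrarily large indices. *)
Lemma diagonal_extraction (R : realType) (u : nat -> nat -> R) (M : nat -> R) :
  (forall j k, `|u j k| <= M j) ->
  exists2 s : nat -> nat, increasing_seq s & forall j, cvgn (u j \o s).
Proof.
move=> uM.
have [F [FU ooF]] := @ultraFilterLemma nat \oo _.
have /choice [c uc] :
    forall j, exists l, forall e : R, 0 < e -> F [set k | `|u j k - l| < e].
  by move=> j; exact: ultrafilter_real_limit (uM j).
pose B n := [set k | forall j, (j <= n)%N -> `|u j k - c j| < n.+1%:R^-1].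
have FB n : F (B n).
  have e0 : 0 < n.+1%:R^-1 :> R by rewrite invr_gt0.
  have : \forall k \near F, forall i : 'I_n.+1, `|u i k - c i| < n.+1%:R^-1.
    by apply: filter_forall => i; exact: uc.
  by apply: filterS => k Bk j jn; apply: (Bk (Ordinal (jn : (j < n.+1)%N))).
have [n N|s s_incr sB] := increasing_selection B.
  have /filter_ex[k [Bk Nk]] : F (B n `&` [set k | (N < k)%N]).
    by apply: filterI => //; apply: ooF; exists N.+1.
  by exists k.
exists s => // j; apply/cvg_ex; exists (c j); apply/cvgrPdist_lt => e e0.
near=> n; rewrite distrC /=.
apply: (@lt_trans _ _ n.+1%:R^-1).
  apply: sB; near: n; exact: nbhs_infty_ge.
by near: n; exact: near_infty_natSinv_lt (PosNum e0).
Unshelve. all: end_near. Qed.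

Lemma telescoping_decrease_cvg0 (R : realType) (d n : nat -> R) (kappa : R) :
  0 < kappa -> (forall k, 0 <= d k) -> (forall k, 0 <= n k) ->
  (forall k, d k.+1 <= d k - kappa * n k) ->
  n k @[k --> \oo] --> (0 : R).
Proof.
move=> kappa0 d0 n0 dS.
have /cvg_ex[L dL] : cvgn d.
  apply: nonincreasing_is_cvgn; last by exists 0 => _ [k _ <-].
  apply/nonincreasing_seqP => k; apply: (le_trans (dS k)).
  by rewrite gerBl mulr_ge0 // ltW.
have dL' : d k.+1 @[k --> \oo] --> L by rewrite (cvg_shiftS d).
apply: (@squeeze_cvgr _ _ _ _ (fun=> 0) (fun k => kappa^-1 * (d k - d k.+1))).
- apply: nearW => k; rewrite n0 /= mulrC ler_pdivlMr // mulrC.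
  by have := dS k; lra.
- exact: cvg_cst.
- rewrite -(mulr0 kappa^-1) -(subrr L); apply: cvgMr; exact: cvgB.
Qed.

Lemma sqr_le_cvg0 (R : realType) (r n : nat -> R) :
  (forall k, 0 <= r k) -> (forall k, r k ^+ 2 <= n k) ->
  n k @[k --> \oo] --> (0 : R) -> r k @[k --> \oo] --> (0 : R).
Proof.
move=> r0 rn /cvgrPdist_lt n_cvg; apply/cvgrPdist_lt => e e0.
have := n_cvg _ (exprn_gt0 2 e0); apply: filterS => k.
rewrite !sub0r !normrN (ger0_norm (r0 k)) => /(le_lt_trans (ler_norm _)) nk.
by rewrite -ltr_sqr ?nnegrE ?(ltW e0) // (le_lt_trans (rn k)).
Qed.

Lemma norm_le_bounded_range (R : realType) (H : completeNormedModType R)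
    (u : nat -> H) (M : R) :
  (forall k, `|u k| <= M) -> bounded_set (range u).
Proof.
move=> uM; exists M; split; first exact: num_real.
by move=> B MB _ [k _ <-]; exact: le_trans (uM k) (ltW MB).
Qed.

(** * Inner products and the Riesz representation theorem *)

Section InnerProduct.
Context {R : realType} {H : completeNormedModType R} {ip : {dot H for idfun}}.
Implicit Types x y z : H.

Lemma ipC x y : ip x y = ip y x.
Proof. by rewrite hermC /= expr0 mul1r. Qed.

Lemma ipPl (a : R) x y z : ip (a *: x + y) z = a * ip x z + ip y z.
Proof. by rewrite linearPl. Qed.

Lemma ipDl x y z : ip (x + y) z = ip x z + ip y z.
Proof. by rewrite linearDl. Qed.

Lemma ipBl x y z : ip (x - y) z = ip x z - ip y z.
Proof. by rewrite linearBl. Qed.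

Lemma ip0l z : ip 0 z = 0.
Proof. by rewrite -(subrr z) ipBl subrr. Qed.

Lemma ipZl (a : R) x z : ip (a *: x) z = a * ip x z.
Proof. by rewrite -[a *: x]addr0 ipPl ip0l addr0. Qed.

Lemma ipDr x y z : ip z (x + y) = ip z x + ip z y.
Proof. by rewrite ipC ipDl !(ipC z). Qed.

Lemma ipBr x y z : ip z (x - y) = ip z x - ip z y.
Proof. by rewrite ipC ipBl !(ipC z). Qed.

Lemma ipZr (a : R) x z : ip z (a *: x) = a * ip z x.
Proof. by rewrite ipC ipZl ipC. Qed.

Context (normH : norm_induced_by ip).

Lemma sqr_norm x : `|x| ^+ 2 = ip x x.
Proof.
rewrite normH sqr_sqrtr //.
have [->|x0] := eqVneq x 0; last exact/ltW/neq0_dnorm_gt0.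
by rewrite ip0l.
Qed.

Lemma sqr_normDZ x y (t : R) :
  `|x + t *: y| ^+ 2 = `|x| ^+ 2 + 2 * t * ip x y + t ^+ 2 * `|y| ^+ 2.
Proof. by rewrite !sqr_norm ipDl !ipDr !ipZl !ipZr (ipC y x); ring. Qed.

Lemma sqr_normB x y : `|x - y| ^+ 2 = `|x| ^+ 2 - 2 * ip x y + `|y| ^+ 2.
Proof. by rewrite -scaleN1r sqr_normDZ; ring. Qed.

Lemma normr_ip_le x y : `|ip x y| <= `|x| * `|y|.
Proof.
have [->|y0] := eqVneq y 0.
  by rewrite ipC ip0l !normr0 mulr0.
have y2 : 0 < `|y| ^+ 2 by rewrite exprn_gt0 // normr_gt0.
rewrite -ler_sqr ?nnegrE ?mulr_ge0 // exprMn real_normK ?num_real //.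
have := mulr_ge0 (sqr_ge0 `|x + (- (ip x y / `|y| ^+ 2)) *: y|) (ltW y2).
rewrite sqr_normDZ -subr_ge0; congr (_ <= _).
by field; rewrite normr_eq0.
Qed.

Lemma norm0_cvg_ipl (u : nat -> H) y :
  `|u k| @[k --> \oo] --> (0 : R) -> ip (u k) y @[k --> \oo] --> (0 : R).
Proof.
move=> u0; apply/norm_cvg0P.
apply: (@squeeze_cvgr _ _ _ _ (fun=> 0) (fun k => `|u k| * `|y|)).
- by apply: nearW => k; rewrite normr_ge0 normr_ip_le.
- exact: cvg_cst.
- by rewrite -(mul0r `|y|); apply: cvgMl.
Qed.

(** The representing vector minimises [J y = `|y| ^+ 2 - 2 * l y] over [V]: by the
    parallelogram law minimising sequences are Cauchy, and the first-order
    condition at the limit is the representation of [l].  Taking [l] to be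
    [ip x] for some [x] yields the orthogonal projection of [x] onto [V]. *)
Lemma riesz_closed_subspace (V : set H) (l : H -> R) (M : R) :
  V 0 -> (forall (a : R) x y, V x -> V y -> V (a *: x + y)) -> closed V ->
  (forall (a : R) x y, V x -> V y -> l (a *: x + y) = a * l x + l y) ->
  (forall y, V y -> `|l y| <= M * `|y|) ->
  exists2 w, V w & forall y, V y -> ip w y = l y.
Proof.
move=> V0 Vlin Vcl lin lM.
have VD x y : V x -> V y -> V (x + y).
  by move=> Vx Vy; rewrite -[x]scale1r; exact: Vlin.
have VZ a x : V x -> V (a *: x).
  by move=> Vx; rewrite -[a *: x]addr0; exact: Vlin.
have lD x y : V x -> V y -> l (x + y) = l x + l y.
  by move=> Vx Vy; rewrite -[x]scale1r lin // mul1r scale1r.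
have l0 : l 0 = 0.
  by apply: (addrI (l 0)); rewrite -lD // !addr0.
have lZ a x : V x -> l (a *: x) = a * l x.
  by move=> Vx; rewrite -[a *: x]addr0 lin // l0 addr0.
pose J (y : H) : R := `|y| ^+ 2 - 2 * l y.
have Jlb y : V y -> - M ^+ 2 <= J y.
  move=> /lM; rewrite ler_norml => /andP[_ ly].
  by rewrite /J; have := sqr_ge0 (`|y| - M); nra.
pose m := inf (J @` V).
have JV : has_inf (J @` V).
  split; first by exists (J 0), 0.
  by exists (- M ^+ 2) => _ [y Vy <-]; exact: Jlb.
have mJ y : V y -> m <= J y.
  by move=> Vy; apply: ge_inf; [case: JV|exists y].
have /choice [v vP] : forall n : nat, exists y, V y /\ J y < m + n.+1%:R^-1.
  move=> n; have /inf_adherent : 0 < n.+1%:R^-1 :> R by rewrite invr_gt0.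
  by move=> /(_ _ JV)[_ [y Vy <-] Jy]; exists y.
have [Vv Jv] : (forall n, V (v n)) /\ (forall n, J (v n) < m + n.+1%:R^-1).
  by split=> n; case: (vP n).
(* [J x + J y - 2 * J ((x + y) / 2)] is half of [`|x - y| ^+ 2]. *)
have near_minimisers x y : V x -> V y ->
    `|x - y| ^+ 2 <= 2 * (J x - m) + 2 * (J y - m).
  move=> Vx Vy; have := mJ _ (VZ 2^-1 _ (VD _ _ Vx Vy)).
  rewrite /J lZ ?lD //; last exact: VD.
  rewrite !sqr_norm ipBl !ipBr ipZl ipZr ipDl !ipDr (ipC y x).
  by move=> h; lra.
have v_cvg : cvgn v.
  apply: cauchy_seq_cvgn => e e0.
  have e4 : 0 < e ^+ 2 / 4 by rewrite divr_gt0 // exprn_gt0.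
  have [N _ NP] := near_infty_natSinv_lt (PosNum e4).
  exists N => k Nk.
  have /= NN := NP N (leqnn N); have /= kN := NP k Nk.
  rewrite -ltr_sqr ?nnegrE // ?ltW //.
  have := near_minimisers _ _ (Vv N) (Vv k); have := Jv N; have := Jv k.
  move: (e ^+ 2) (`|v N - v k| ^+ 2) (J _) (J _) (N.+1%:R^-1) (k.+1%:R^-1) NN kN.
  by move=> *; lra.
have /cvg_ex[w vw] := v_cvg.
exists w.
  by apply: (closed_cvg V Vcl _ _ vw); exact: nearW.
move=> y Vy.
have vwy : ip (v n) y @[n --> \oo] --> ip w y.
  apply/subr_cvg0.
  under eq_fun do rewrite -ipBl.
  apply: norm0_cvg_ipl; exact/norm_cvg0P/subr_cvg0.
(* Compare [J (v n + t *: y)] with the infimum and let [n] tend to infinity. *)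
have Jge t : 0 <= 2 * t * (ip w y - l y) + t ^+ 2 * `|y| ^+ 2.
  have : (2 * t * (ip (v n) y - l y) + t ^+ 2 * `|y| ^+ 2 + n.+1%:R^-1)
      @[n --> \oo] --> 2 * t * (ip w y - l y) + t ^+ 2 * `|y| ^+ 2 + 0.
    apply: cvgD; last exact: cvg_harmonic.
    apply: cvgD; last exact: cvg_cst.
    apply: cvgMr; apply: cvgB => //; exact: cvg_cst.
  rewrite addr0 => /cvgr_to_ge; apply; apply: nearW => n.
  have := mJ _ (Vlin t _ _ Vy (Vv n)); have := Jv n.
  rewrite /J lin // [t *: y + v n]addrC sqr_normDZ.
  by move: (n.+1%:R^-1) => h; clearbody m; lra.
(* With [d := ip w y - l y], the choice [t = - d / (q + 1)] makes the quadratic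
   [2 * t * d + t ^+ 2 * q] equal to [- r ^+ 2 * (q + 2)], where [r = - t]. *)
apply/eqP; rewrite -subr_eq0; set d := ip w y - l y in Jge *.
set q := `|y| ^+ 2 in Jge; have q0 : 0 <= q by exact: sqr_ge0.
have q1 : q + 1 != 0 by rewrite gt_eqF // ltr_wpDl.
have [r dr] : exists r, d = r * (q + 1) by exists (d / (q + 1)); rewrite divfK.
have r0 : r = 0.
  have := Jge (- r); rewrite dr => h.
  by apply/eqP; rewrite -sqrf_eq0; apply/eqP; nra.
by rewrite dr r0 mul0r.
Qed.

End InnerProduct.

(** * Weak compactness and Fejer monotone sequences *)

Section WeakConvergence.
Context {R : realType} {H : completeNormedModType R} {ip : {dot H for idfun}}.
Context (normH : norm_induced_by ip).
Implicit Types x y z : H.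

(** Boundedness makes the functionals [ip (u k)] equicontinuous, so convergence
    passes from nearby vectors to [y]. *)
Lemma closed_cvgn_ip (u : nat -> H) (M : R) :
  (forall k, `|u k| <= M) -> closed [set y | cvgn (fun k => ip (u k) y)].
Proof.
move=> uM y yV; have M0 : 0 <= M := le_trans (normr_ge0 _) (uM 0%N).
apply: (@cauchy_seq_cvgn R R^o) => e e0.
have d0 : 0 < e / (4 * (M + 1)) by rewrite divr_gt0 // mulr_gt0 // ltr_wpDl.
have [v [/= v_cvg]] := yV _ (nbhsx_ballx y _ d0).
rewrite -ball_normE /= ltr_pdivlMr ?mulr_gt0 ?ltr_wpDl // => yv.
have /cvgrPdist_lt/(_ (e / 4)) : cvgn (fun k => ip (u k) v) by [].
rewrite divr_gt0 // => /(_ isT)[N _ NP].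
exists N => k Nk; have := NP N (leqnn N); have := NP k Nk => /=.
set L := lim _; move=> Lk LN.
have -> : ip (u N) y - ip (u k) y =
    (ip (u N) v - L) + (L - ip (u k) v) + ip (u N) (y - v) - ip (u k) (y - v).
  by rewrite !ipBr; ring.
have b j : `|ip (u j) (y - v)| <= M * `|y - v|.
  by apply: (le_trans (normr_ip_le normH _ _)); rewrite ler_wpM2r.
have := ler_normB (ip (u N) v - L + (L - ip (u k) v) + ip (u N) (y - v))
  (ip (u k) (y - v)).
have := ler_normD (ip (u N) v - L + (L - ip (u k) v)) (ip (u N) (y - v)).
have := ler_normD (ip (u N) v - L) (L - ip (u k) v).
rewrite [in X in X -> _](distrC (ip (u N) v)).
have := b k; have := b N; have := normr_ge0 (y - v).
move: yv Lk LN; nra.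
Qed.

(** The limit functional [l] of the extracted subsequence lives on the closed
    subspace [V] of vectors where the limit exists, and its Riesz representative
    in [V] is the weak limit.  Since [V] contains the whole sequence, vectors
    orthogonal to [V] contribute nothing. *)
Lemma bounded_weak_subsequence (u : nat -> H) (M : R) :
  (forall k, `|u k| <= M) ->
  exists2 s, increasing_seq s & exists z, weakly_converges ip (u \o s) z.
Proof.
move=> uM.
have [j k|s s_incr u_cvg] :=
  @diagonal_extraction R (fun j k => ip (u k) (u j)) (fun j => M * `|u j|).
  by apply: (le_trans (normr_ip_le normH _ _)); rewrite ler_wpM2r.
exists s => //.
have usM k : `|(u \o s) k| <= M := uM _.
pose V := [set y | cvgn (fun k => ip ((u \o s) k) y)].
pose l y : R := lim (ip ((u \o s) k) y @[k --> \oo]).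
have lP y : V y -> ip ((u \o s) k) y @[k --> \oo] --> l y by [].
have lin (a : R) x y : V x -> V y ->
    ip ((u \o s) k) (a *: x + y) @[k --> \oo] --> a * l x + l y.
  move=> /lP Vx /lP Vy; under eq_fun do rewrite ipDr ipZr.
  by apply: cvgD => //; exact: cvgMr.
have V0 : V 0.
  apply/cvg_ex; exists 0; under eq_fun do rewrite ipC ip0l.
  exact: cvg_cst.
have Vlin (a : R) x y : V x -> V y -> V (a *: x + y).
  by move=> Vx Vy; apply/cvg_ex; exists (a * l x + l y); exact: lin.
have Vcl : closed V := closed_cvgn_ip _ _ usM.
have riesz := riesz_closed_subspace normH V _ _ V0 Vlin Vcl.
have [||w Vw wl] := riesz l M.
- by move=> a x y Vx Vy; apply/cvg_lim => //; exact: lin.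
- move=> y /lP/cvg_norm/cvgr_to_le; apply; apply: nearW => k.
  by apply: (le_trans (normr_ip_le normH _ _)); rewrite ler_wpM2r.
exists w => y.
(* The orthogonal projection [p] of [y] onto [V] has the same inner products as
   [y] with the terms of [u], which all lie in [V]. *)
have [||p Vp py] := riesz (ip y) `|y|.
- by move=> a x x' _ _; rewrite ipDr ipZr.
- by move=> x _; exact: normr_ip_le.
have -> : (fun k => ip ((u \o s) k) y) = (fun k => ip ((u \o s) k) p).
  by apply/funext => k /=; rewrite ipC -py ?(ipC _ p) //; exact: u_cvg.
by rewrite ipC -py // ipC wl //; exact: lP.
Qed.

(** Opial's argument: the distances to [w] and to [w'] both converge, and the
    difference of their squares is affine in [ip (x k) (w - w')], so this inner
    product has a single limit, equal to both [ip w (w - w')] and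
    [ip w' (w - w')]. *)
Lemma fejer_weak_cluster_unique (C : set H) (x : nat -> H) w w' :
  (forall z, C z -> forall k, `|x k.+1 - z| <= `|x k - z|) ->
  weak_cluster_point ip x w -> weak_cluster_point ip x w' ->
  C w -> C w' -> w = w'.
Proof.
move=> fejer [s /increasing_seq_cvgn s_oo xw].
move=> [s' /increasing_seq_cvgn s'_oo xw'] Cw Cw'.
have dist_cvg z : C z -> cvgn (fun k => `|x k - z| ^+ 2).
  move=> Cz; apply: nonincreasing_is_cvgn.
    apply/nonincreasing_seqP => k; rewrite ler_sqr ?nnegrE //; exact: fejer.
  by exists 0 => _ [k _ <-]; exact: sqr_ge0.
have /cvg_ex[L xL] : cvgn (fun k => ip (x k) (w - w')).
  rewrite (_ : (fun k => _) = (fun k => 2^-1 *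
      (`|x k - w'| ^+ 2 - `|x k - w| ^+ 2 + (`|w| ^+ 2 - `|w'| ^+ 2)))).
    apply: is_cvgMr; apply: is_cvgD; last exact: is_cvg_cst.
    by apply: is_cvgB; exact: dist_cvg.
  by apply/funext => k; rewrite !(sqr_normB normH) ipBr; field.
have wL : ip w (w - w') = L.
  apply: (cvg_unique _ (xw (w - w'))) => //; exact: (cvg_comp _ _ s_oo xL).
have w'L : ip w' (w - w') = L.
  apply: (cvg_unique _ (xw' (w - w'))) => //; exact: (cvg_comp _ _ s'_oo xL).
apply/eqP; rewrite -subr_eq0 -normr_eq0 -sqrf_eq0 (sqr_norm normH).
by rewrite ipBl wL w'L subrr.
Qed.

Lemma fejer_bounded (C : set H) (x : nat -> H) :
  C !=set0 ->
  (forall z, C z -> forall k, `|x k.+1 - z| <= `|x k - z|) ->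
  exists M : R, forall k, `|x k| <= M.
Proof.
move=> [z0 Cz0] fejer; exists (`|x 0%N - z0| + `|z0|) => k.
have : `|x k - z0| <= `|x 0%N - z0|.
  by elim: k => // k; exact: le_trans (fejer _ Cz0 k).
by have := ler_normD (x k - z0) z0; rewrite subrK; lra.
Qed.

(** If the inner products with some [y] stayed away from their expected limit along
    a subsequence, compactness would give a second weak cluster point. *)
Lemma fejer_weak_cvg (C : set H) (x : nat -> H) :
  C !=set0 ->
  (forall z, C z -> forall k, `|x k.+1 - z| <= `|x k - z|) ->
  (forall z, weak_cluster_point ip x z -> C z) ->
  exists2 z, C z & weakly_converges ip x z.
Proof.
move=> C0 fejer clC; have [M xM] := fejer_bounded C x C0 fejer.
have [s s_incr [w xw]] := bounded_weak_subsequence x _ xM.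
have wcl : weak_cluster_point ip x w by exists s.
exists w; first exact: clC.
move=> y; apply: contrapT => /cvgrPdist_lt /existsNP[e /not_implyP[e0 nearN]].
have [_ N|f f_incr fP] :=
  increasing_selection (fun=> [set k | e <= `|ip w y - ip (x k) y|]).
  apply: contrapT => noex; apply: nearN; exists N.+1 => // k /= Nk.
  by rewrite ltNge; apply/negP => ek; apply: noex; exists k.
have [t t_incr [w' xw']] :=
  bounded_weak_subsequence (x \o f) _ (fun k => xM (f k)).
have w'cl : weak_cluster_point ip x w'.
  by exists (f \o t) => // m n /=; rewrite f_incr; exact: t_incr.
have ww' : w = w'.
  by apply: (fejer_weak_cluster_unique C x) => //; exact: clC.
have /cvgrPdist_lt/(_ e e0)[N _ /(_ N (leqnn N)) /=] := xw' y.
by rewrite -ww' ltNge fP.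
Qed.

Lemma weakly_converges_perturb (u v : nat -> H) z :
  weakly_converges ip u z -> `|v k - u k| @[k --> \oo] --> (0 : R) ->
  weakly_converges ip v z.
Proof.
move=> uz vu y.
rewrite (_ : (fun k => _) = (fun k => ip (v k - u k) y + ip (u k) y)).
  rewrite -[ip z y]add0r; apply: cvgD; last exact: uz.
  exact: norm0_cvg_ipl.
by apply/funext => k; rewrite ipBl subrK.
Qed.

End WeakConvergence.

(** * Compositions of demicontractions *)

Section Demicontractions.
Context {R : realType} {H : completeNormedModType R} {ip : {dot H for idfun}}.
Context (normH : norm_induced_by ip).
Implicit Types x y z : H.

Lemma demicontraction_ip (alpha : R) (T : H -> H) x z :
  demicontraction alpha T -> Fixpts T z ->
  (1 - alpha) * `|T x - x| ^+ 2 <= 2 * ip (T x - x) (z - x).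
Proof.
move=> [_ _ Tdemi] Tz; have := Tdemi x z Tz.
rewrite (_ : T x - z = (T x - x) - (z - x)); last by rewrite opprB addrA subrK.
rewrite (sqr_normB normH) -(normrN (z - x)) opprB; lra.
Qed.

(** Determinant over trace of the symmetric matrix with diagonal [p], [q] and
    off-diagonal entries [1]: a lower bound for its smallest eigenvalue that avoids
    square roots. *)
Definition coercivity (p q : R) : R := (p * q - 1) / (p + q).

Lemma coercivity_gt0 (p q : R) :
  0 < p -> 0 < q -> 1 < p * q -> 0 < coercivity p q.
Proof. by move=> p0 q0 pq1; apply: divr_gt0; lra. Qed.

(** With [c := coercivity p q], the form minus [c * (`|a| ^+ 2 + `|b| ^+ 2)] has
    determinant [(p - c) * (q - c) - 1 = c ^+ 2 >= 0], so completing the square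
    in [a] leaves a nonnegative multiple of [`|b| ^+ 2]. *)
Lemma coercive_form (p q : R) (a b : H) :
  0 < p -> 0 < q -> 1 < p * q ->
  coercivity p q * (`|a| ^+ 2 + `|b| ^+ 2)
    <= p * `|a| ^+ 2 + q * `|b| ^+ 2 + 2 * ip a b.
Proof.
move=> p0 q0 pq1; set c := coercivity p q.
have cpq : c * (p + q) = p * q - 1 by rewrite divfK // gt_eqF // addr_gt0.
have c0 : 0 < c by apply: divr_gt0; clearbody c; lra.
clearbody c.
have pc : 0 < p - c by nra.
have := sqr_ge0 `|a + (p - c)^-1 *: b|; rewrite (sqr_normDZ normH).
rewrite -(pmulr_rge0 _ pc) => h.
have {h} : 0 <= (p - c) * `|a| ^+ 2 + 2 * ip a b + (p - c)^-1 * `|b| ^+ 2.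
  apply: (le_trans h); rewrite le_eqVlt; apply/orP; left; apply/eqP.
  by field; rewrite gt_eqF.
have : (p - c)^-1 <= q - c.
  by rewrite -[leLHS]mul1r ler_pdivrMr //; nra.
have := sqr_ge0 `|b|; nra.
Qed.

Lemma sqr_normD_le (a b : H) : `|a + b| ^+ 2 <= 2 * (`|a| ^+ 2 + `|b| ^+ 2).
Proof.
have := sqr_ge0 `|a - b|; rewrite (sqr_normB normH).
by rewrite -[b in `|a + b|]scale1r (sqr_normDZ normH); lra.
Qed.

(** The inequality of [U] is used at [T x], and moving its base point from [T x] to
    [x] produces the cross term [2 * ip a b]. *)
Lemma composition_ip (alpha beta : R) (T U : H -> H) x z :
  demicontraction alpha T -> demicontraction beta U ->
  Fixpts T z -> Fixpts U z ->
  (1 - alpha) * `|T x - x| ^+ 2 + (1 - beta) * `|U (T x) - T x| ^+ 2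
    + 2 * ip (T x - x) (U (T x) - T x) <= 2 * ip (U (T x) - x) (z - x).
Proof.
move=> T_demi U_demi Tz Uz.
have := demicontraction_ip _ _ x _ T_demi Tz.
have := demicontraction_ip _ _ (T x) _ U_demi Uz.
rewrite (ipC (T x - x) (U (T x) - T x)) !ipBl !ipBr; lra.
Qed.

(** With [t = lambda / tau], expanding the square subtracts
    [2 * t * ip (U (T x) - x) (z - x) >= t * D] and adds
    [t ^+ 2 * `|U (T x) - x| ^+ 2 <= t ^+ 2 * tau * D / 2 = t * lambda * D / 2],
    a net loss of at least [t * (2 - lambda) * D / 2].  At a fixed point of
    [U \o T], where [tau] is unconstrained, the bound on [D] forces [a = b = 0] and
    there is nothing to lose. *)
Lemma relaxed_step_decrease (alpha beta : R) (T U : H -> H)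
    (M tau lambda eps : R) x z :
  demicontraction alpha T -> demicontraction beta U ->
  alpha + beta < alpha * beta ->
  Fixpts T z -> Fixpts U z -> 0 < tau -> 0 < eps -> 0 < M ->
  eps <= lambda <= 2 - eps ->
  (~ Fixpts (U \o T) x ->
   2 * `|(T x - x) + (U (T x) - T x)| ^+ 2 /
     ((1 - alpha) * `|T x - x| ^+ 2 + (1 - beta) * `|U (T x) - T x| ^+ 2
       + 2 * ip (T x - x) (U (T x) - T x)) <= tau /\ tau <= M) ->
  `|x + (lambda / tau) *: (U (T x) - x) - z| ^+ 2 <=
  `|x - z| ^+ 2
    - eps ^+ 2 * coercivity (1 - alpha) (1 - beta) / (2 * M)
      * (`|T x - x| ^+ 2 + `|U (T x) - T x| ^+ 2).
Proof.
move=> T_demi U_demi alpha_beta Tz Uz tau0 eps0 M0 /andP[lam_ge lam_le].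
move=> tau_bnd.
have p0 : 0 < 1 - alpha by case: T_demi; rewrite subr_gt0.
have q0 : 0 < 1 - beta by case: U_demi; rewrite subr_gt0.
have pq1 : 1 < (1 - alpha) * (1 - beta) by lra.
have := composition_ip _ _ _ _ x z T_demi U_demi Tz Uz.
have := coercive_form _ _ (T x - x) (U (T x) - T x) p0 q0 pq1.
have := coercivity_gt0 _ _ p0 q0 pq1; move: (coercivity _ _) => c c0.
have abE : (T x - x) + (U (T x) - T x) = U (T x) - x.
  by rewrite addrC addrA subrK.
have : `|U (T x) - x| ^+ 2 <= 2 * (`|T x - x| ^+ 2 + `|U (T x) - T x| ^+ 2).
  by rewrite -abE; exact: sqr_normD_le.
move: tau_bnd; rewrite abE.
have : 0 <= `|T x - x| ^+ 2 + `|U (T x) - T x| ^+ 2.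
  by rewrite addr_ge0 ?sqr_ge0.
move: (`|T x - x| ^+ 2 + `|U (T x) - T x| ^+ 2) => N N0.
move: (_ + _ + 2 * ip (T x - x) _) => D tau_bnd eN cD Dip.
rewrite [in leLHS]addrAC (sqr_normDZ normH).
have [UTx|nUTx] := pselect (Fixpts (U \o T) x).
  have UTx0 : U (T x) - x = 0 by apply/eqP; rewrite subr_eq0; apply/eqP.
  rewrite UTx0 ip0l mulr0 in Dip.
  have -> : N = 0.
    by apply/le_anti; rewrite N0 andbT -(pmulr_rle0 _ c0) (le_trans cD Dip).
  by rewrite UTx0 ipC ip0l normr0 expr0n /= !mulr0 subr0 !addr0.
have [tau_ge tau_le] := tau_bnd nUTx.
have e0 : 0 < `|U (T x) - x| ^+ 2.
  by rewrite exprn_gt0 // normr_gt0 subr_eq0; apply/eqP.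
have D0 : 0 < D.
  have : 0 < N by lra.
  by move=> ?; apply: (lt_le_trans _ cD); rewrite mulr_gt0.
rewrite ler_pdivrMr // in tau_ge.
rewrite (ipC (x - z)) -(opprB z x) -scaleN1r ipZr.
have t0 : 0 < lambda / tau by rewrite divr_gt0 // (lt_le_trans eps0).
have lamE : lambda = lambda / tau * tau by rewrite divfK // gt_eqF.
(* [lambda * (2 - lambda) >= eps ^+ 2], both factors being at least [eps]. *)
have tM : eps ^+ 2 / M <= lambda / tau * (2 - lambda).
  apply: (@le_trans _ _ (lambda * (2 - lambda) / M)).
    by rewrite ler_pM2r ?invr_gt0 //; nra.
  rewrite mulrAC ler_wpM2r //; first lra.
  by rewrite ler_wpM2l ?lef_pV2 //; lra.
have tD : eps ^+ 2 * c / (2 * M) * N <= lambda / tau * (2 - lambda) * D / 2.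
  apply: (@le_trans _ _ (eps ^+ 2 / M * (c * N) / 2)).
    rewrite le_eqVlt; apply/orP; left; apply/eqP; field; rewrite gt_eqF //.
  rewrite ler_pM2r ?invr_gt0 //; apply: ler_pM => //.
    by rewrite divr_ge0 ?sqr_ge0 // ltW.
  by rewrite mulr_ge0 // ltW.
move: tD t0 lamE; move: (lambda / tau) => t tD t0 lamE.
have : 0 <= t * (2 * ip (U (T x) - x) (z - x) - D).
  by rewrite mulr_ge0 ?subr_ge0 // ltW.
have : 0 <= t ^+ 2 * (tau * D - 2 * `|U (T x) - x| ^+ 2).
  by rewrite mulr_ge0 ?subr_ge0 ?sqr_ge0.
rewrite scaleN1r normrN.
move: tD; rewrite {1}lamE; lra.
Qed.

End Demicontractions.

Theorem corollary4p6 (R : realType) (H : completeNormedModType R)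
  (ip : {dot H for idfun}) (normH : norm_induced_by ip)
  (H_nontrivial : exists v : H, v != 0)
  (alpha beta : R) (alpha_lt1 : alpha < 1) (beta_lt1 : beta < 1)
  (T U : H -> H)
  (T_demi : demicontraction alpha T) (U_demi : demicontraction beta U)
  (common_fix : Fixpts T `&` Fixpts U !=set0)
  (T_closed : demiclosed ip T) (U_closed : demiclosed ip U)
  (alpha_beta : alpha + beta < alpha * beta)
  (tau : H -> R) (tau_gt0 : forall x : H, 0 < tau x)
  (tau_bounds : forall x : H, ~ Fixpts (U \o T) x ->
    let a1 := T x - x in
    let b1 := U (T x) - T x in
    2 * `|a1 + b1| ^+ 2
      / ((1 - alpha) * `|a1| ^+ 2 + (1 - beta) * `|b1| ^+ 2 + 2 * ip a1 b1)
      <= tau x /\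
    tau x <= 2 * (alpha + beta) / (alpha + beta - alpha * beta))
  (x0 : H) (eps : R) (eps_gt0 : 0 < eps) (eps_lt1 : eps < 1)
  (lambda : nat -> R)
  (lambda_bounds : forall k : nat, eps <= lambda k /\ lambda k <= 2 - eps)
  (x : nat -> H) (x_init : x 0%N = x0)
  (x_step : forall k : nat,
    x k.+1 = x k + (lambda k / tau (x k)) *: (U (T (x k)) - x k)) :
  exists2 z : H, (Fixpts T `&` Fixpts U) z & weakly_converges ip x z.
Proof.
(* [1 - alpha] and [1 - beta] have product above [1], hence sum above [2]. *)
have ab0 : alpha + beta < 0 by have := sqr_ge0 (alpha - beta); nra.
have M0 : 0 < 2 * (alpha + beta) / (alpha + beta - alpha * beta).
  by rewrite ltr_ndivlMr ?mul0r; lra.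
set M := 2 * _ / _ in tau_bounds M0.
pose res k := `|T (x k) - x k| ^+ 2 + `|U (T (x k)) - T (x k)| ^+ 2.
have res0 k : 0 <= res k by rewrite addr_ge0 ?sqr_ge0.
have [kappa kappa0 decrease] : exists2 kappa, 0 < kappa & forall z,
    (Fixpts T `&` Fixpts U) z -> forall k,
    `|x k.+1 - z| ^+ 2 <= `|x k - z| ^+ 2 - kappa * res k.
  exists (eps ^+ 2 * coercivity (1 - alpha) (1 - beta) / (2 * M)).
    have c0 : 0 < coercivity (1 - alpha) (1 - beta).
      by apply: coercivity_gt0; [lra|lra|lra].
    by apply: divr_gt0; apply: mulr_gt0 => //; exact: exprn_gt0.
  move=> z [Tz Uz] k; rewrite x_step.
  apply: (relaxed_step_decrease normH alpha beta) => //.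
    by apply/andP; exact: lambda_bounds.
  exact: tau_bounds.
have res_cvg0 : res k @[k --> \oo] --> (0 : R).
  have [z0 Cz0] := common_fix.
  apply: (telescoping_decrease_cvg0 _ (fun k => `|x k - z0| ^+ 2) _ kappa) => //.
  exact: decrease.
have fejer z : (Fixpts T `&` Fixpts U) z ->
    forall k, `|x k.+1 - z| <= `|x k - z|.
  move=> Cz k; rewrite -ler_sqr ?nnegrE //; apply: (le_trans (decrease z Cz k)).
  by rewrite gerBl mulr_ge0 // ltW.
have T_asymp : `|T (x k) - x k| @[k --> \oo] --> (0 : R).
  by apply: (sqr_le_cvg0 _ _ res) => // k; rewrite lerDl sqr_ge0.
have U_asymp : `|U (T (x k)) - T (x k)| @[k --> \oo] --> (0 : R).
  by apply: (sqr_le_cvg0 _ _ res) => // k; rewrite lerDr sqr_ge0.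
have [B xB] := fejer_bounded _ _ common_fix fejer.
apply: (fejer_weak_cvg normH _ _ common_fix fejer) => z z_cluster; split.
  by apply: (T_closed x) => //; exact: norm_le_bounded_range xB.
apply: (U_closed (T \o x)) => //.
(* [T (x k)] is bounded and has the weak cluster points of [x k], because it
   differs from [x k] by a null sequence. *)
- have [K [_ aK]] := cvg_seq_bounded (cvgP _ T_asymp).
  apply: (@norm_le_bounded_range _ _ _ (K + 1 + B)) => k /=.
  have := aK (K + 1); rewrite ltrDl => /(_ ltr01 k I) /=; rewrite normr_id => ak.
  have := ler_normD (T (x k) - x k) (x k); rewrite subrK.
  have := xB k; lra.
- have [s s_incr xz] := z_cluster; exists s => //.
  apply: (weakly_converges_perturb normH _ _ _ xz).
  exact: (cvg_comp _ _ (increasing_seq_cvgn _ s_incr) T_asymp).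
Qed.
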